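(* Let $A$ be a locally maximal linking strategy (local maximizer) of the relaxed HITS authority optimization problem, with associated authority vector $u$, and derivative of the objective with respect to the weighted adjacency matrix at the optimum equal to $(Aw)u^T+(Au)w^T$. For every controlled page $i$ having at least one outlink, denote $b_i=\frac{-(Aw)_i}{(Au)_i}$. Then all facultative hyperlinks $(i,j)$ such that $\frac{w_j}{u_j}>b_i$ get a weight of $1$ (i.e. $A_{i,j}=1$) and all facultative hyperlinks $(i,j)$ such that $\frac{w_j}{u_j}<b_i$ get a weight of $0$ (i.e. $A_{i,j}=0$). In particular, if two controlled pages with different values of $b_i$ have the same sets of facultative outlinks, then their sets of activated outlinks are included one in the other.
   Context: There are $n$ web pages. The set of potential links $(i,j)$ is partitioned into obligatory links $\mathcal{O}$, prohibited links $\mathcal{I}$ and facultative links $\mathcal{F}$. Fix $\xi>0$, let $e$ be the all-ones vector of $\mathbb{R}^n$, and let $f:\mathbb{R}^n\to\mathbb{R}$ be continuously differentiable. The relaxed HITS authority optimization problem is to maximize $f(u)$ over $A\in\mathbb{R}^{n\times n}$, $u\in\mathbb{R}^n$, $\rho\in\mathbb{R}$ subject to $$(A^TA+\xi ee^T)u=\rho u,\quad \|u\|_2=1,\quad u\ge0,$$ $$A_{i,j}=1\ \forall(i,j)\in\mathcal{O},\qquad A_{i,j}=0\ \forall(i,j)\in\mathcal{I},\qquad 0\le A_{i,j}\le1\ \forall(i,j)\in\mathcal{F}.$$ Thus $u$ (the authority vector) and $\rho$ are the normalized Perron vector and Perron root of the positive matrix $A^TA+\xi ee^T$, determined by $A$.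 The vector $w$ is given by $$w^T=\bigl(-\nabla f(u)^T+(\nabla f(u)\cdot u)\,u^T\bigr)(A^TA+\xi ee^T-\rho I)^{\#},$$ where $\#$ denotes the Drazin inverse. With this $w$, the matrix of partial derivatives of $A\mapsto f(u)$ is $(Aw)u^T+(Au)w^T$. A page is controlled if it has facultative outlinks. Page $i$ has at least one outlink if $A_{i,j}>0$ for some $j$. The facultative outlinks of page $i$ are identified with the pages $j$ such that $(i,j)\in\mathcal{F}$, and the activated outlinks of page $i$ with the pages $j$ such that $(i,j)\in\mathcal{F}$ and $A_{i,j}>0$. *)

(* Defs.v *)
From HB Require Import structures.
From mathcomp Require Import all_boot all_order all_algebra.
From mathcomp Require Import all_classical all_reals all_analysis.
From mathcomp Require Import ring.
Import Order.TTheory GRing.Theory Num.Theory.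
Import numFieldNormedType.Exports.

Set Implicit Arguments.
Unset Strict Implicit.
Unset Printing Implicit Defensive.

Local Open Scope ring_scope.

Definition is_drazin (K : fieldType) (n : nat) (M X : 'M[K]_n) : Prop :=
  [/\ M *m X = X *m M, X *m M *m X = X
    & exists k : nat, M ^+ k.+1 *m X = M ^+ k].

Lemma is_drazin_exists (K : fieldType) (n : nat) (M : 'M[K]_n) :
  exists X, is_drazin M X.
Proof.
case: n M => [|n] M.
  by exists 0; split; [apply/matrixP => -[]..| exists 0%N; apply/matrixP => -[]].
have [k [q q0 qE]] := multiplicity_XsubC (char_poly M) 0.
rewrite monic_neq0 ?char_poly_monic //= in q0.
have q00 : q.[0] != 0 by [].
have /factor_theorem[r rE] : root (1 - q.[0]^-1 *: q) 0.
  by apply/rootP; rewrite !hornerE mulVf// subrr.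
rewrite subr0 in qE rE.
have kE p : horner_mx M ('X^k * p) = horner_mx M ('X^k * p * ('X * r)).
  apply/eqP; rewrite -subr_eq0 -rmorphB /=.
  have -> : 'X^k * p - 'X^k * p * ('X * r) = char_poly M * (q.[0]^-1%:P * p).
    rewrite qE [in RHS](_ : q * _ * _ = 'X^k * p * (q.[0]^-1%:P * q)); last by ring.
    by rewrite mul_polyC -[_ *: q](subKr 1) rE; ring.
  by rewrite rmorphM /= Cayley_Hamilton mul0r.
have kmE m p : horner_mx M ('X^k * p) = horner_mx M ('X^k * p * ('X * r) ^+ m).
  elim: m => [|m IH]; first by rewrite expr0 mulr1.
  by rewrite IH -mulrA kE !mulrA exprSr !mulrA.
have XE j : M ^+ j = horner_mx M 'X^j by rewrite rmorphXn /= horner_mx_X.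
exists (horner_mx M ('X^k * r ^+ k.+1)); split; last exists k.
- by rewrite -{1 4}[M]expr1 XE !mulmxE -!rmorphM /= mulrC.
- rewrite -{2}[M]expr1 XE !mulmxE -!rmorphM /= [RHS](kmE k.+1); congr horner_mx.
  by rewrite exprMn !exprS; ring.
- rewrite !XE !mulmxE -!rmorphM /= -['X^k in RHS]mulr1 [RHS](kmE k.+1).
  by congr horner_mx; rewrite exprMn !exprS; ring.
Qed.

Lemma is_drazin_uniq (K : fieldType) (n : nat) (M X Y : 'M[K]_n) :
  is_drazin M X -> is_drazin M Y -> X = Y.
Proof.
rewrite /is_drazin !mulmxE; case=> MX XMX [j jX] [MY YMY [k kY]].
have powX m : M ^+ (m + j).+1 * X = M ^+ (m + j).
  by elim: m => [|m IH]; rewrite // addSn exprS -mulrA IH -exprS.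
have powY m : M ^+ (m + k).+1 * Y = M ^+ (m + k).
  by elim: m => [|m IH]; rewrite // addSn exprS -mulrA IH -exprS.
have XXM : X * X * M = X by rewrite -[RHS]XMX -!mulrA MX.
have MYY : M * (Y * Y) = Y by rewrite -[RHS]YMY mulrA MY.
have iterX m : X = X ^+ m.+1 * M ^+ m.
  elim: m => [|m IH]; first by rewrite mulr1.
  by rewrite {1}IH exprSr -{2}XXM !mulrA -!exprSr -mulrA -exprS.
have iterY m : Y = M ^+ m * Y ^+ m.+1.
  elim: m => [|m IH]; first by rewrite mul1r.
  by rewrite [LHS]IH [Y ^+ m.+1]exprS -{1}MYY mulrA mulrA -exprSr -!mulrA -!exprS.
have cX m : M ^+ m * X = X * M ^+ m by apply/commr_sym/commrX/esym.
rewrite [LHS](iterX (j + k)%N) -powY [M ^+ _.+1]exprSr -!mulrA mulrA -iterX.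
rewrite [in RHS](iterY (k + j)%N) -powX cX [M ^+ _.+1]exprS -!mulrA.
by rewrite -iterY.
Qed.

(* By [drazinP] and [is_drazin_uniq], the default value 0 is never used. *)
Definition drazin (K : fieldType) (n : nat) (M : 'M[K]_n) : 'M[K]_n :=
  xget 0 [set X | is_drazin M X]%classic.

Lemma drazinP (K : fieldType) (n : nat) (M : 'M[K]_n) : is_drazin M (drazin M).
Proof. by have [X MX] := is_drazin_exists M; exact: (xgetI 0 MX). Qed.

Section hits.
Variables (R : realType) (n : nat).
Implicit Types (A : 'M[R]_n) (u : 'cV[R]_n) (f : 'cV[R]_n -> R).
Implicit Types (obl proh fac : {set 'I_n * 'I_n}).

(* [`|u|] on matrices is the sup norm, hence the explicit Euclidean norm. *)
Definition norm2 u : R := Num.sqrt (\sum_(j < n) u j 0 ^+ 2).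

Definition grad f u : 'cV[R]_n := \col_j 'D_(delta_mx j 0) f u.

Definition continuously_differentiable f : Prop :=
  (forall u, differentiable f u) /\ continuous (grad f).

Definition link_partition obl proh fac : Prop :=
  [/\ [disjoint obl & proh], [disjoint obl & fac], [disjoint proh & fac]
    & obl :|: proh :|: fac = [set: 'I_n * 'I_n]%SET].

Definition hits_mx (xi : R) A : 'M[R]_n :=
  A^T *m A + xi *: (const_mx 1 *m (const_mx 1 : 'cV[R]_n)^T).

Definition feasible obl proh fac (xi : R) A u (rho : R) : Prop :=
  [/\ hits_mx xi A *m u = rho *: u,
      norm2 u = 1,
      forall j, 0 <= u j 0
    & [/\ forall i j, (i, j) \in obl -> A i j = 1,
          forall i j, (i, j) \in proh -> A i j = 0
        & forall i j, (i, j) \in fac -> 0 <= A i j <= 1]].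

Definition local_maximizer obl proh fac (xi : R) f A u (rho : R) : Prop :=
  feasible obl proh fac xi A u rho /\
  \forall p \near (A, u, rho),
    feasible obl proh fac xi p.1.1 p.1.2 p.2 -> f p.1.2 <= f u.

(* The vector w for which (A w) u^T + (A u) w^T is the matrix of partial
   derivatives of A |-> f u. *)
Definition wvec (xi : R) f A u (rho : R) : 'cV[R]_n :=
  ((- (grad f u)^T + ((grad f u)^T *m u) 0 0 *: u^T)
     *m drazin (hits_mx xi A - rho%:M))^T.

Definition controlled fac (i : 'I_n) : Prop := exists j, (i, j) \in fac.

Definition has_outlink A (i : 'I_n) : Prop := exists j, 0 < A i j.

Definition fac_outlinks fac (i : 'I_n) : {set 'I_n} :=
  [set j | (i, j) \in fac]%SET.

Definition activated_outlinks fac A (i : 'I_n) : {set 'I_n} :=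
  [set j | ((i, j) \in fac) && (0 < A i j)]%SET.

Definition threshold A u (w : 'cV[R]_n) (i : 'I_n) : R :=
  - (A *m w) i 0 / (A *m u) i 0.

End hits.

(* Main.v *)
Require Import Defs.
From mathcomp Require Import all_boot all_order all_algebra.
From mathcomp Require Import all_classical all_reals all_analysis.
From mathcomp Require Import ring lra.
Import Order.TTheory GRing.Theory Num.Theory.
Import numFieldNormedType.Exports.

(** At a local maximizer the weight of one facultative link $(i,j)$ can be
    varied alone, so the sign of the partial derivative
    $D_{ij} = (Aw)_i u_j + (Au)_i w_j$ decides that weight: $D_{ij} > 0$ forces
    the upper bound 1 and $D_{ij} < 0$ the lower bound 0
    ([facultative_weight]). Since $u_j > 0$ and $(Au)_i > 0$ for a page with an
    outlink, $D_{ij} > 0$ means exactly that $w_j / u_j$ exceeds the threshold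
    $b_i$. The nesting of the activated sets follows: if $b_i < b_k$, an activated
    link $(k,j)$ has $w_j / u_j \ge b_k > b_i$, so $A_{ij} = 1$.

    The substance is that $w$ does compute the derivative of the objective
    along a curve $A + tH$, $t \to 0^+$, of admissible matrices
    ([first_order_condition]). Write $M_t$ for the matrix built from $A + tH$.

    - A nonnegative unit eigenvector $v_t$ of $M_t$ exists
      ([nonneg_eigenvector]): since $M_t$ is symmetric with nonnegative entries,
      the vector of absolute values of a maximizer of its quadratic form on the
      unit sphere is again a maximizer, hence an eigenvector.

    - The derivative of $v_t$ comes from exact identities. As the eigenvalue
      $\rho$ of $M_0$ is simple, $X = (M_0 - \rho)^\#$ satisfies
      $X (M_0 - \rho) = I - u u^T$ and $X u = 0$. Applying $u^T$ and $X$ to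
      $(M_0 - \rho) v_t = (r_t - \rho) v_t - (M_t - M_0) v_t$ gives
      ([shift_eigenvector])
      $(r_t - \rho)\, u \cdot v_t = u \cdot (M_t - M_0) v_t$ and
      $v_t - (u \cdot v_t) u = (r_t - \rho) X v_t - X (M_t - M_0) v_t$.
      Since $u$ has positive entries and $v_t$ is nonnegative of norm 1,
      $u \cdot v_t$ is bounded below, so the first identity gives
      $r_t \to \rho$, the second gives $v_t \to u$, and dividing by $t$ gives
      $v_t' = - X M' u$ at 0 ([eigenvector_deriv]).

    The derivative of the objective is then $- \nabla f(u)^T X M' u$, which is
    $w^T M' u$ because $u^T X = 0$, and for $H = E_{ij}$ this is $D_{ij}$. *)

Set Implicit Arguments.
Unset Strict Implicit.
Unset Printing Implicit Defensive.

Local Open Scope ring_scope.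

(** * The Euclidean inner product *)

Definition dot (R : realType) (n : nat) (x y : 'cV[R]_n) : R := (x^T *m y) 0 0.

Section dot.
Variables (R : realType) (n : nat).
Implicit Types (x y z : 'cV[R]_n) (M : 'M[R]_n).

Lemma dotE x y : dot x y = \sum_i x i 0 * y i 0.
Proof. by rewrite /dot mxE; apply: eq_bigr => i _; rewrite mxE. Qed.

Lemma dotC x y : dot x y = dot y x.
Proof. by rewrite !dotE; apply: eq_bigr => i _; rewrite mulrC. Qed.

Lemma dotDr x y z : dot x (y + z) = dot x y + dot x z.
Proof. by rewrite /dot mulmxDr mxE. Qed.

Lemma dot0r x : dot x 0 = 0.
Proof. by rewrite /dot mulmx0 mxE. Qed.

Lemma dotNr x y : dot x (- y) = - dot x y.
Proof. by rewrite /dot mulmxN mxE. Qed.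

Lemma dotZr a x y : dot x (a *: y) = a * dot x y.
Proof. by rewrite /dot -scalemxAr mxE. Qed.

Lemma dotDl x y z : dot (x + y) z = dot x z + dot y z.
Proof. by rewrite dotC dotDr !(dotC z). Qed.

Lemma dotNl x y : dot (- x) y = - dot x y.
Proof. by rewrite dotC dotNr dotC. Qed.

Lemma dotZl a x y : dot (a *: x) y = a * dot x y.
Proof. by rewrite dotC dotZr dotC. Qed.

Lemma dot_mulmx M x y : dot x (M *m y) = dot (M^T *m x) y.
Proof. by rewrite /dot trmx_mul trmxK mulmxA. Qed.

Lemma dot_ge0 x : 0 <= dot x x.
Proof. by rewrite dotE sumr_ge0// => i _; rewrite -expr2 sqr_ge0. Qed.

Lemma dot_eq0 x : dot x x = 0 -> x = 0.
Proof.
rewrite dotE => /psumr_eq0P x0; apply/colP => i; rewrite mxE; apply/eqP.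
by rewrite -sqrf_eq0 expr2 x0// => j _; rewrite -expr2 sqr_ge0.
Qed.

Lemma norm2_1P x : norm2 x = 1 <-> dot x x = 1.
Proof.
have -> : norm2 x = Num.sqrt (dot x x).
  by rewrite /norm2 dotE; congr Num.sqrt; apply: eq_bigr => i _; rewrite expr2.
split=> [x1|->]; last exact: sqrtr1.
by rewrite -[LHS]sqr_sqrtr ?dot_ge0// x1 expr1n.
Qed.

Lemma dot1_coord x j : dot x x = 1 -> `|x j 0| <= 1.
Proof.
move=> x1; rewrite -(@ler_pXn2r _ 2) ?nnegrE// expr1n real_normK ?num_real//.
rewrite -x1 dotE (bigD1 j)//= -expr2 lerDl sumr_ge0// => i _.
by rewrite -expr2 sqr_ge0.
Qed.

End dot.

(** * Nonnegative eigenvectors and Rayleigh quotients *)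

Section perron.
Variables (R : realType) (n : nat) (M : 'M[R]_n).
Hypothesis M_gt0 : forall i j, 0 < M i j.

Lemma mulmx_gt0 (x : 'cV[R]_n) :
  (forall j, 0 <= x j 0) -> x <> 0 -> forall i, 0 < (M *m x) i 0.
Proof.
move=> x0 xN0 i; rewrite mxE.
have xi0 j : 0 <= M i j * x j 0 by rewrite mulr_ge0// ltW.
rewrite lt_neqAle sumr_ge0// andbT eq_sym; apply/eqP => /psumr_eq0P s0.
apply: xN0; apply/colP => j; rewrite mxE.
have /eqP := s0 (fun j _ => xi0 j) j isT.
by rewrite mulf_eq0 gt_eqF//= => /eqP.
Qed.

Variables (u : 'cV[R]_n) (rho : R).
Hypothesis Mu : M *m u = rho *: u.
Hypothesis u_ge0 : forall j, 0 <= u j 0.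
Hypothesis u_neq0 : u <> 0.

Lemma eigenvalue_gt0 : 0 < rho.
Proof.
have [j uj] : exists j, u j 0 != 0.
  apply: contrapT => u0; apply: u_neq0; apply/colP => j; rewrite mxE.
  by apply/eqP/negPn/negP => uj; apply: u0; exists j.
have := mulmx_gt0 u_ge0 u_neq0 j; rewrite Mu mxE.
by rewrite pmulr_lgt0// lt_neqAle eq_sym uj u_ge0.
Qed.

Lemma eigenvector_gt0 j : 0 < u j 0.
Proof.
have := mulmx_gt0 u_ge0 u_neq0 j.
by rewrite Mu mxE pmulr_rgt0// eigenvalue_gt0.
Qed.

(** Subtracting from [x] the largest multiple of [u] that keeps the difference
    nonnegative leaves an eigenvector with a zero coordinate, and a nonzero
    nonnegative eigenvector of a positive matrix has none. *)
Lemma eigenvector_simple x : M *m x = rho *: x -> exists c, x = c *: u.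
Proof.
move=> Mx.
have [j0] : exists j0 : 'I_n, True.
  have [//|noj] := pselect (exists j0 : 'I_n, True).
  by case: u_neq0; apply/colP => j; case: noj; exists j.
move=> _.
pose q j := x j 0 / u j 0.
have [j _ qmin] := arg_minP q (erefl : xpredT j0); exists (q j).
apply/eqP; rewrite -subr_eq0; apply/eqP; apply: contrapT => y0.
set y := x - _ in y0.
have yge0 k : 0 <= y k 0.
  rewrite !mxE subr_ge0 -ler_pdivlMr ?eigenvector_gt0//; exact: qmin.
have My : M *m y = rho *: y.
  by rewrite mulmxBr -scalemxAr Mx Mu scalerBr !scalerA mulrC.
have := mulmx_gt0 yge0 y0 j.
by rewrite My !mxE divfK ?subrr ?mulr0 ?ltxx// gt_eqF// eigenvector_gt0.
Qed.

End perron.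

Section rayleigh.
Variables (R : realType) (n : nat) (M : 'M[R]_n).
Hypothesis Msym : M^T = M.

(** The quadratic form of $r I - M$ is nonnegative and vanishes at [x], so its
    linear part at [x], tested in the direction $M x - r x$, vanishes as
    well. *)
Lemma rayleigh_eigen (r : R) (x : 'cV[R]_n) :
  (forall z, dot z (M *m z) <= r * dot z z) ->
  dot x (M *m x) = r * dot x x -> M *m x = r *: x.
Proof.
move=> le_r eq_r; apply/eqP; rewrite -subr_eq0; apply/eqP/dot_eq0.
have [z zE] : exists z, z = M *m x - r *: x by eexists.
rewrite -zE.
have lin s : 2 * s * dot z z <= s ^+ 2 * (r * dot z z - dot z (M *m z)).
  have := le_r (x + s *: z).
  rewrite mulmxDr -scalemxAr !(dotDl, dotDr, dotZl, dotZr).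
  rewrite (dotC x z) [dot x (M *m z)]dot_mulmx Msym [dot (M *m x) z]dotC eq_r.
  have -> : dot z (M *m x) = dot z z + r * dot z x.
    by rewrite {3}zE dotDr dotNr dotZr subrK.
  by lra.
have := dot_ge0 z; rewrite le_eqVlt => /orP[/eqP->//|z_gt0].
set q := r * _ - _ in lin.
have q0 : 0 <= q by rewrite subr_ge0 le_r.
(* The quadratic $q s^2 - 2 |z|^2 s$ is negative at this point. *)
pose s := dot z z / (q + 1).
have s0 : 0 < s by rewrite divr_gt0// ltr_wpDl.
have sq : s * q <= dot z z.
  rewrite /s mulrAC ler_pdivrMr ?ltr_wpDl// ler_wpM2l ?(ltW z_gt0)//.
  by rewrite lerDl.
have := lin s; rewrite [2 * s]mulrC -mulrA expr2 -mulrA ler_pM2l//.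
by lra.
Qed.

End rayleigh.

(** * The Drazin inverse at a simple eigenvalue *)

Section drazin_simple.
Variables (R : realType) (n : nat) (K : 'M[R]_n).
Hypothesis Ksym : K^T = K.

(** A symmetric matrix has index at most 1: $|K^{k+1} x|^2$ is the inner product
    of $K^k x$ and $K^{k+2} x$. *)
Lemma sym_ker_pow (x : 'cV[R]_n) k : K ^+ k.+1 *m x = 0 -> K *m x = 0.
Proof.
elim: k => [|k IH]; first by rewrite expr1.
rewrite exprS -mulmxE -mulmxA => Kx; apply: IH; apply: dot_eq0.
rewrite {1}exprS -mulmxE -mulmxA -{1}Ksym -dot_mulmx Kx.
by rewrite /dot mulmx0 mxE.
Qed.

Variable u : 'cV[R]_n.
Hypothesis Ku : K *m u = 0.
Hypothesis u1 : dot u u = 1.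
Hypothesis simple : forall x, K *m x = 0 -> exists c, x = c *: u.

Lemma dot_ker x : dot u (K *m x) = 0.
Proof. by rewrite dot_mulmx Ksym Ku /dot trmx0 mul0mx mxE. Qed.

(** The product of [K] and its Drazin inverse is the orthogonal projection away
    from [u]: $x - K^\# K x$ is killed by a power of [K], hence by [K], so it is
    a multiple of [u], and $K^\# K x = K K^\# x$ is orthogonal to [u]. *)
Lemma drazin_mulmxE x : drazin K *m (K *m x) = x - dot u x *: u.
Proof.
have [KX _ [k kE]] := drazinP K.
have [c cE] : exists c, x - drazin K *m (K *m x) = c *: u.
  apply: simple; apply: (@sym_ker_pow _ k).
  by rewrite mulmxBr [X in _ - X]mulmxA kE mulmxA mulmxE -exprSr subrr.
have : dot u (c *: u) = dot u x.
  by rewrite -cE mulmxA -KX -mulmxA dotDr dotNr dot_ker subr0.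
by rewrite dotZr u1 mulr1 => <-; rewrite -cE subKr.
Qed.

Lemma drazin_ker : drazin K *m u = 0.
Proof.
have [KX XKX _] := drazinP K.
by rewrite -{1}XKX -[_ *m K *m _]mulmxA KX -!mulmxA Ku !mulmx0.
Qed.

Lemma drazin_coker : u^T *m drazin K = 0.
Proof.
have [KX XKX _] := drazinP K.
have uK : u^T *m K = 0 by rewrite -{1}Ksym -trmx_mul Ku trmx0.
by rewrite -{1}XKX -KX !mulmxA uK !mul0mx.
Qed.

End drazin_simple.

(** * Limits of matrices *)

Section cvg_matrix.
Local Open Scope classical_set_scope.
Variables (R : realType) (T : Type) (F : set_system T).
Context {FF : Filter F}.

Lemma cvg_mx m n (f : T -> 'M[R]_(m, n)) (a : 'M[R]_(m, n)) :
  (forall i j, f t i j @[t --> F] --> a i j) -> f t @[t --> F] --> a.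
Proof.
move=> fa; apply/cvgrPdist_le => e e0; near=> t.
rewrite [leLHS]/Num.Def.normr/= mx_normrE (bigmax_le _ (ltW e0))//= => i _.
rewrite !mxE; move: i; near: t; apply: filter_forall => -[i j] /=.
exact: (cvgrPdist_le _ _).1 (fa i j) e e0.
Unshelve. all: by end_near. Qed.

Lemma cvg_coord m n (f : T -> 'M[R]_(m, n)) (a : 'M[R]_(m, n)) i j :
  f t @[t --> F] --> a -> f t i j @[t --> F] --> a i j.
Proof.
move=> fa; apply: (@cvg_comp _ _ _ f (fun M : 'M[R]_(m, n) => M i j) _ _ _ fa).
exact: coord_continuous.
Qed.

Lemma cvg_trmx m n (f : T -> 'M[R]_(m, n)) (a : 'M[R]_(m, n)) :
  f t @[t --> F] --> a -> (f t)^T @[t --> F] --> a^T.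
Proof.
move=> fa; apply: cvg_mx => i j; rewrite mxE.
by under eq_fun do rewrite mxE; exact: cvg_coord.
Qed.

Lemma cvg_mulmx m n p (f : T -> 'M[R]_(m, n)) (g : T -> 'M[R]_(n, p))
    (a : 'M[R]_(m, n)) (b : 'M[R]_(n, p)) :
  f t @[t --> F] --> a -> g t @[t --> F] --> b ->
  f t *m g t @[t --> F] --> a *m b.
Proof.
move=> fa gb; apply: cvg_mx => i j; rewrite mxE.
under eq_fun do rewrite mxE.
apply: cvg_big => [|k _]; first exact: add_continuous.
by apply: cvgM; exact: cvg_coord.
Qed.

Lemma cvg_dot n (f g : T -> 'cV[R]_n) (a b : 'cV[R]_n) :
  f t @[t --> F] --> a -> g t @[t --> F] --> b ->
  dot (f t) (g t) @[t --> F] --> dot a b.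
Proof. by move=> fa gb; apply/cvg_coord/cvg_mulmx => //; exact: cvg_trmx. Qed.

End cvg_matrix.

Lemma normr_mulmx (R : realType) m n p (M : 'M[R]_(m, n)) (N : 'M[R]_(n, p)) :
  `|M *m N| <= n%:R * `|M| * `|N|.
Proof.
rewrite [leLHS]/Num.Def.normr/= mx_normrE bigmax_le//= => [[i j] _].
rewrite mxE (le_trans (ler_norm_sum _ _ _))//.
have -> : n%:R * `|M| * `|N| = \sum_(k < n) `|M| * `|N|.
  by rewrite sumr_const card_ord -mulrA mulr_natl.
have coord q r (Q : 'M[R]_(q, r)) k l : `|Q k l| <= `|Q|.
  by rewrite [leRHS]/Num.Def.normr/= mx_normrE (le_bigmax _ _ (k, l)).
by apply: ler_sum => k _; rewrite normrM ler_pM.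
Qed.

Section bounded.
Local Open Scope classical_set_scope.

Lemma cvg0_mulmx_bounded (R : realType) (T : Type) (F : set_system T)
    (FF : Filter F) m n p (f : T -> 'M[R]_(m, n)) (g : T -> 'M[R]_(n, p)) (C : R) :
  f t @[t --> F] --> (0 : 'M[R]_(m, n)) -> (\forall t \near F, `|g t| <= C) ->
  f t *m g t @[t --> F] --> (0 : 'M[R]_(m, p)).
Proof.
move=> f0 gC; apply: norm_cvg0.
apply: (@squeeze_cvgr _ _ _ _ (fun=> 0) (fun t => n%:R * `|f t| * C)).
- near=> t; rewrite normr_ge0 (le_trans (normr_mulmx _ _))//.
  by rewrite ler_wpM2l ?mulr_ge0//; near: t.
- exact: cvg_cst.
- have -> : (0 : R) = n%:R * 0 * C by rewrite mulr0 mul0r.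
  apply: cvgM; last exact: cvg_cst.
  apply: cvgM; first exact: cvg_cst.
  by move/norm_cvg0P : f0.
Unshelve. all: by end_near. Qed.

End bounded.

(** * Existence of a nonnegative unit eigenvector *)

Section existence.
Local Open Scope classical_set_scope.
Variables (R : realType) (n : nat) (M : 'M[R]_n).
Hypothesis Msym : M^T = M.
Hypothesis M_ge0 : forall i j, 0 <= M i j.

(** A maximizer [x] of the quadratic form on the compact unit sphere need not be
    nonnegative, but taking absolute values does not decrease the form, the
    entries of [M] being nonnegative. *)
Lemma nonneg_eigenvector : (0 < n)%N -> exists (v : 'cV[R]_n) (r : R),
  [/\ M *m v = r *: v, dot v v = 1 & forall j, 0 <= v j 0].
Proof.
move=> n_gt0.
pose sphere := [set x : 'rV[R]_n | dot x^T x^T = 1].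
pose q (x : 'rV[R]_n) := dot x^T (M *m x^T).
have cvgT (x : 'rV[R]_n) : y^T @[y --> x] --> x^T.
  exact: (@cvg_trmx _ _ _ (nbhs_filter x) _ _ id x cvg_id).
have sphere_neq0 : sphere !=set0.
  exists (delta_mx 0 (Ordinal n_gt0)).
  by rewrite /sphere/= trmx_delta /dot trmx_delta mul_delta_mx mxE !eqxx.
have sphere_compact : compact sphere.
  apply: bounded_closed_compact.
    exists 1; split=> // e e1 x x1 /=.
    rewrite [leLHS]/Num.Def.normr/= mx_normrE bigmax_le//= => [|[i j] _].
      exact: le_trans (ltW e1).
    have := dot1_coord j x1; rewrite mxE ord1 => /le_trans; apply; exact: ltW.
  rewrite (_ : sphere = (fun x : 'rV[R]_n => dot x^T x^T) @^-1` [set y | y = 1])//.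
  move: (@closed_eq R 1); apply: (continuous_closedP _).1.
  by move=> x; exact: (cvg_dot (cvgT x) (cvgT x)).
have q_cont : {within sphere, continuous q}.
  apply: continuous_subspaceT => x; apply: (cvg_dot (cvgT x) (cvg_mulmx _ (cvgT x))).
  exact: cvg_cst.
have [x xS xmax] := EVT_max_rV sphere_neq0 sphere_compact q_cont.
have {}xS : dot x^T x^T = 1 by move: xS; rewrite inE.
have {}xmax (z : 'cV[R]_n) : dot z z = 1 -> dot z (M *m z) <= q x.
  by move=> z1; have := xmax z^T; rewrite /q trmxK; apply; rewrite inE/sphere/= trmxK.
pose v : 'cV[R]_n := \col_i `|x 0 i|.
have v1 : dot v v = 1.
  rewrite -xS !dotE; apply: eq_bigr => i _; rewrite !mxE.
  by rewrite -normrM ger0_norm// -expr2 sqr_ge0.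
exists v, (q x); split=> //; last by move=> j; rewrite mxE.
apply: rayleigh_eigen => // [z|].
  have [->|z0] := eqVneq z 0; first by rewrite mulmx0 /dot mulmx0 mxE mulr0.
  have z_gt0 : 0 < dot z z.
    rewrite lt_neqAle dot_ge0 andbT eq_sym; apply/eqP => /dot_eq0/eqP.
    by rewrite (negbTE z0).
  pose s := (Num.sqrt (dot z z))^-1.
  have s2 : s ^+ 2 = (dot z z)^-1 by rewrite exprVn sqr_sqrtr ?dot_ge0.
  have := xmax (s *: z).
  rewrite -scalemxAr !(dotZl, dotZr) !mulrA -expr2 s2 mulVf ?gt_eqF// => /(_ erefl).
  by rewrite mulrC ler_pdivrMr.
rewrite v1 mulr1; apply/eqP; rewrite eq_le xmax//= /q !dotE.
apply: ler_sum => i _; rewrite !mxE (le_trans (ler_norm _))// normrM.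
rewrite ler_wpM2l// (le_trans (ler_norm_sum _ _ _))//.
by apply: ler_sum => j _; rewrite !mxE normrM (ger0_norm (M_ge0 _ _)).
Qed.

End existence.

(** * Perturbation of a simple eigenvalue *)

Section perturbation.
Local Open Scope classical_set_scope.
Variables (R : realType) (n : nat) (M0 : 'M[R]_n) (u : 'cV[R]_n) (rho : R).
Hypothesis M0sym : M0^T = M0.
Hypothesis M0_gt0 : forall i j, 0 < M0 i j.
Hypothesis M0u : M0 *m u = rho *: u.
Hypothesis u1 : dot u u = 1.
Hypothesis u_ge0 : forall j, 0 <= u j 0.

Let K : 'M[R]_n := M0 - rho%:M.
Let X := drazin K.

Let u_neq0 : u <> 0.
Proof.
by move=> u0; move: u1; rewrite u0 /dot mulmx0 mxE => /eqP; rewrite eq_sym oner_eq0.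
Qed.

Let KE (x : 'cV[R]_n) : K *m x = M0 *m x - rho *: x.
Proof. by rewrite mulmxBl mul_scalar_mx. Qed.

Let Ksym : K^T = K.
Proof. by rewrite linearB/= M0sym tr_scalar_mx. Qed.

Let Ku : K *m u = 0.
Proof. by rewrite KE M0u subrr. Qed.

Let Ksimple (x : 'cV[R]_n) : K *m x = 0 -> exists c, x = c *: u.
Proof.
move=> /eqP; rewrite KE subr_eq0 => /eqP.
exact: (eigenvector_simple M0_gt0 M0u u_ge0 u_neq0).
Qed.

(** Both equations are read off from
    $(M_0 - \rho) v = (r - \rho) v - (M - M_0) v$, the first by taking the inner
    product with [u], the second by applying [X]. *)
Lemma shift_eigenvector (M : 'M[R]_n) v r : M *m v = r *: v ->
  (r - rho) * dot u v = dot u ((M - M0) *m v) /\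
  v - dot u v *: u = (r - rho) *: (X *m v) - X *m ((M - M0) *m v).
Proof.
move=> Mv.
have Kv : K *m v = (r - rho) *: v - (M - M0) *m v.
  by rewrite KE mulmxBl Mv scalerBl opprB [RHS]addrC subrKA.
have := dot_ker Ksym Ku v; rewrite Kv dotDr dotNr dotZr => /eqP.
rewrite subr_eq0 => /eqP <-; split=> //.
by rewrite -(drazin_mulmxE Ksym Ku u1 Ksimple) Kv mulmxBr scalemxAr.
Qed.

(** If $m$ is the least entry of [u] and 1, then
    $u \cdot v \ge m \sum_j v_j \ge m \sum_j v_j^2 = m$, as $0 \le v_j \le 1$.
    This keeps the eigenvectors of the perturbed matrices away from the
    orthogonal complement of [u], where the first equation of
    [shift_eigenvector] says nothing about the eigenvalue. *)
Lemma dot_lower_bound : exists2 m, 0 < m &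
  forall v : 'cV[R]_n, dot v v = 1 -> (forall j, 0 <= v j 0) -> m <= dot u v.
Proof.
pose m := \big[Order.min/1]_(j < n) u j 0.
exists m => [|v v1 v0].
  apply/bigmin_gtP; split=> // j _.
  exact: (eigenvector_gt0 M0_gt0 M0u u_ge0 u_neq0).
have m0 : 0 <= m by apply/bigmin_geP; split.
rewrite -[m]mulr1 -v1 !dotE mulr_sumr; apply: ler_sum => j _.
have vj1 : v j 0 <= 1 by rewrite (le_trans (ler_norm _))// dot1_coord.
apply: (@le_trans _ _ (m * v j 0)).
  by rewrite ler_wpM2l// -[leRHS]mulr1 ler_wpM2l.
by rewrite ler_wpM2r// bigmin_le.
Qed.

(* The curve [v] will come from a choice of one eigenvector for each $t$, so that
   its convergence has to be a conclusion. *)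
Variables (M : R -> 'M[R]_n) (M' : 'M[R]_n) (v : R -> 'cV[R]_n) (r : R -> R).
Hypothesis M_deriv : t^-1 *: (M t - M0) @[t --> 0^'+] --> M'.
Hypothesis v_eigen : \forall t \near 0^'+,
  [/\ M t *m v t = r t *: v t, dot (v t) (v t) = 1 & forall j, 0 <= v t j 0].

Let c t := dot u (v t).
Let v_perp t := v t - c t *: u.

Let right_filter : Filter (at_right (0 : R)) := _.

Let id_cvg : t @[t --> 0^'+] --> (0 : R).
Proof. exact: cvg_at_right_filter cvg_id. Qed.

Let norm_v : \forall t \near 0^'+, `|v t| <= 1.
Proof.
near=> t; rewrite [leLHS]/Num.Def.normr/= mx_normrE bigmax_le//= => [[i j] _].
by rewrite ord1 dot1_coord//; near: t; apply: filterS v_eigen => t [].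
Unshelve. all: by end_near. Qed.

Let M_cvg : M t - M0 @[t --> 0^'+] --> (0 : 'M[R]_n).
Proof.
have : t *: (t^-1 *: (M t - M0)) @[t --> 0^'+] --> (0 : R) *: M' by apply: cvgZ.
rewrite scale0r; apply: cvg_trans; apply: near_eq_cvg; near=> t.
by rewrite scalerA divff ?scale1r.
Unshelve. all: by end_near. Qed.

Lemma eigenvalue_cvg : r t @[t --> 0^'+] --> rho.
Proof.
have [m m0 mP] := dot_lower_bound.
apply/subr_cvg0; apply: norm_cvg0.
have Mv0 : (M t - M0) *m v t @[t --> 0^'+] --> (0 : 'cV[R]_n).
  exact: cvg0_mulmx_bounded M_cvg norm_v.
apply: (@squeeze_cvgr _ _ right_filter R (fun=> 0)
  (fun t => `|dot u ((M t - M0) *m v t)| * m^-1)).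
- near=> t; rewrite normr_ge0/= ler_pdivlMr//.
  have [Mv v1 v0] : [/\ M t *m v t = r t *: v t, dot (v t) (v t) = 1
    & forall j, 0 <= v t j 0] by near: t.
  have [<- _] := shift_eigenvector Mv.
  by rewrite normrM ler_wpM2l// (le_trans (mP _ v1 v0))// ler_norm.
- exact: cvg_cst.
- have := cvgM (cvg_norm (cvg_dot (cvg_cst u) Mv0)) (cvg_cst m^-1).
  by rewrite dot0r normr0 mul0r; apply.
Unshelve. all: by end_near. Qed.

Let v_perpE : \forall t \near 0^'+,
  v_perp t = (r t - rho) *: (X *m v t) - X *m ((M t - M0) *m v t).
Proof. by apply: filterS v_eigen => t [/shift_eigenvector[_ perpE] _ _]. Qed.

Let v_perp_cvg : v_perp t @[t --> 0^'+] --> (0 : 'cV[R]_n).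
Proof.
have rX0 : (r t - rho) *: X @[t --> 0^'+] --> (0 : 'M[R]_n).
  rewrite -(scale0r X); apply: cvgZ (cvg_cst X).
  exact/subr_cvg0/eigenvalue_cvg.
have lim0 : ((r t - rho) *: X) *m v t - X *m ((M t - M0) *m v t) @[t --> 0^'+]
    --> 0 - X *m 0.
  apply: cvgB; first exact: cvg0_mulmx_bounded rX0 norm_v.
  apply: cvg_mulmx; first exact: cvg_cst.
  exact: cvg0_mulmx_bounded M_cvg norm_v.
rewrite mulmx0 subr0 in lim0; apply: cvg_trans lim0.
apply: near_eq_cvg.
by apply: filterS v_perpE => t ->; rewrite scalemxAl.
Qed.

Let c_gt0 : \forall t \near 0^'+, 0 < c t.
Proof.
have [m m0 mP] := dot_lower_bound.
by apply: filterS v_eigen => t [_ v1 v0]; rewrite (lt_le_trans m0)// mP.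
Qed.

(** By Pythagoras, $1 - c_t^2 = |v_t^\perp|^2$: the component of [v t] along [u]
    differs from 1 only at second order, so it does not contribute to the
    derivative. *)
Let c_defect : \forall t \near 0^'+,
  1 - c t = dot (v_perp t) (v_perp t) / (1 + c t).
Proof.
near=> t; have c0 : 0 < c t by near: t.
have v1 : dot (v t) (v t) = 1 by near: t; apply: filterS v_eigen => t [].
apply: (canRL (mulfK _)); first by rewrite gt_eqF// addr_gt0.
rewrite /v_perp !(dotDl, dotDr, dotNl, dotNr, dotZl, dotZr) v1 u1.
by rewrite [dot (v t) u]dotC -/(c t); ring.
Unshelve. all: by end_near. Qed.

Let c_cvg : c t @[t --> 0^'+] --> (1 : R).
Proof.
suff lim : 1 - c t @[t --> 0^'+] --> (0 : R).
  have lim1 : 1 - (1 - c t) @[t --> 0^'+] --> 1 - (0 : R).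
    exact: cvgB (cvg_cst (1 : R)) lim.
  rewrite subr0 in lim1; apply: cvg_trans lim1; apply: near_eq_cvg.
  by near=> t; rewrite /= subKr.
apply: (@squeeze_cvgr _ _ _ R (fun=> 0) (fun t => dot (v_perp t) (v_perp t))).
- near=> t; have c0 : 0 < c t by near: t.
  have -> : 1 - c t = dot (v_perp t) (v_perp t) / (1 + c t) by near: t.
  rewrite divr_ge0 ?dot_ge0 ?addr_ge0 ?(ltW c0)//=.
  by rewrite ler_pdivrMr ?addr_gt0// ler_peMr ?dot_ge0// lerDl ltW.
- exact: cvg_cst.
- have lim0 := cvg_dot v_perp_cvg v_perp_cvg; rewrite dot0r in lim0.
  exact: lim0.
Unshelve. all: by end_near. Qed.

Lemma eigenvector_cvg : v t @[t --> 0^'+] --> u.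
Proof.
have lim : v_perp t + c t *: u @[t --> 0^'+] --> 0 + 1 *: u.
  by apply: cvgD => //; exact: cvgZ c_cvg (cvg_cst u).
rewrite add0r scale1r in lim; apply: cvg_trans lim.
by apply: near_eq_cvg; near=> t; rewrite subrK.
Unshelve. all: by end_near. Qed.

(** In the quotient of [shift_eigenvector] by $t$, the term with the derivative
    of the eigenvalue disappears in the limit because $X v_t \to X u = 0$. *)
Lemma eigenvector_deriv :
  t^-1 *: (v t - u) @[t --> 0^'+] --> - (X *m (M' *m u)).
Proof.
have M'v : (t^-1 *: (M t - M0)) *m v t @[t --> 0^'+] --> M' *m u.
  exact: cvg_mulmx M_deriv eigenvector_cvg.
have r_deriv : t^-1 * (r t - rho) @[t --> 0^'+] --> dot u (M' *m u) / 1.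
  apply: cvg_trans (cvgM (cvg_dot (cvg_cst u) M'v) (cvgV (oner_neq0 R) c_cvg)).
  apply: near_eq_cvg; near=> t; have c0 : 0 < c t by near: t.
  have [Mv _ _] : [/\ M t *m v t = r t *: v t, dot (v t) (v t) = 1
    & forall j, 0 <= v t j 0] by near: t.
  have [rE _] := shift_eigenvector Mv.
  by rewrite /= -scalemxAl dotZr -rE -/(c t) mulrA mulfK// gt_eqF.
have perp_deriv : t^-1 *: v_perp t @[t --> 0^'+] --> - (X *m (M' *m u)).
  have lim : (t^-1 * (r t - rho)) *: (X *m v t)
        - X *m ((t^-1 *: (M t - M0)) *m v t) @[t --> 0^'+]
      --> (dot u (M' *m u) / 1) *: (X *m u) - X *m (M' *m u).
    apply: cvgB; last exact: cvg_mulmx (cvg_cst X) M'v.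
    exact: cvgZ r_deriv (cvg_mulmx (cvg_cst X) eigenvector_cvg).
  rewrite (drazin_ker Ku) scaler0 sub0r in lim; apply: cvg_trans lim.
  apply: near_eq_cvg; near=> t.
  have -> : v_perp t = (r t - rho) *: (X *m v t) - X *m ((M t - M0) *m v t).
    by near: t.
  by rewrite -scalerA -scalemxAl -scalemxAr -scalerBr.
have c_deriv : t^-1 * (1 - c t) @[t --> 0^'+] --> (0 : R).
  have lim0 : t * (dot (t^-1 *: v_perp t) (t^-1 *: v_perp t) / (1 + c t))
      @[t --> 0^'+] --> 0 * (dot (- (X *m (M' *m u))) (- (X *m (M' *m u))) / (1 + 1)).
    apply: cvgM => //; apply: cvgM; first exact: cvg_dot.
    by apply: cvgV => //; apply: cvgD => //; exact: cvg_cst.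
  rewrite mul0r in lim0; apply: cvg_trans lim0; apply: near_eq_cvg; near=> t.
  have -> : 1 - c t = dot (v_perp t) (v_perp t) / (1 + c t) by near: t.
  by rewrite dotZl dotZr !mulrA divff ?mul1r.
have lim : t^-1 *: v_perp t - (t^-1 * (1 - c t)) *: u @[t --> 0^'+]
    --> - (X *m (M' *m u)) - 0 *: u.
  exact: cvgB perp_deriv (cvgZ c_deriv (cvg_cst u)).
rewrite scale0r subr0 in lim; apply: cvg_trans lim; apply: near_eq_cvg.
near=> t; rewrite -scalerA -scalerBr scalerBl scale1r /v_perp.
by rewrite opprB addrA subrK.
Unshelve. all: by end_near. Qed.

End perturbation.

(** * Differentiation along a curve *)

Section right_derivative.
Local Open Scope classical_set_scope.

(** The chain rule with a right derivative inside: the curve is only controlled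
    for $t > 0$, where $A + tH$ respects the constraints. *)
Lemma right_deriv_comp (R : realType) (V : normedModType R) (f : V -> R)
    (v : R -> V) (u d : V) :
  differentiable f u -> v t @[t --> 0^'+] --> u ->
  t^-1 *: (v t - u) @[t --> 0^'+] --> d ->
  t^-1 * (f (v t) - f u) @[t --> 0^'+] --> 'd f u d.
Proof.
move=> df vu vd.
have /diff_locallyP[df_cont /eqaddoP f_lin] := df.
have main_part : 'd f u (t^-1 *: (v t - u)) @[t --> 0^'+] --> 'd f u d.
  apply: (@cvg_comp _ _ _ (fun t => t^-1 *: (v t - u)) ('d f u) _ _ _ vd).
  exact: df_cont.
have err : t^-1 * (f (v t) - f u - 'd f u (v t - u)) @[t --> 0^'+] --> (0 : R).
  apply/cvgr0Pnorm_le => e e0.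
  pose C := `|d| + 1.
  have C0 : 0 < C by rewrite ltr_wpDl.
  have w0 : v t - u @[t --> 0^'+] --> (0 : V) by apply/subr_cvg0.
  have nearC : \forall t \near 0^'+, `|t^-1 *: (v t - u)| < C.
    by apply: (cvgr_norm_lt _ vd); rewrite ltrDl.
  near=> t.
  have qC : `|t^-1 *: (v t - u)| < C by near: t.
  have : `|f (v t) - f u - 'd f u (v t - u)| <= e / C * `|v t - u|.
    have -> : f (v t) - f u - 'd f u (v t - u) =
        (f \o shift u - (cst (f u) + 'd f u)) (v t - u).
      by rewrite !fctE /= subrK opprD addrA.
    by near: t; apply: (w0 _ (f_lin _ (divr_gt0 e0 C0))).
  move=> h; rewrite normrM; apply: (@le_trans _ _ (e / C * `|t^-1 *: (v t - u)|)).
    by rewrite normrZ mulrCA ler_wpM2l.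
  by rewrite mulrAC ler_pdivrMr// ler_wpM2l// ltW.
have lim : 'd f u (t^-1 *: (v t - u)) +
  t^-1 * (f (v t) - f u - 'd f u (v t - u)) @[t --> 0^'+] --> 'd f u d + 0.
  exact: cvgD main_part err.
rewrite addr0 in lim; apply: cvg_trans lim; apply: near_eq_cvg; near=> t.
by rewrite linearZ /= -mulrDr addrC subrK.
Unshelve. all: by end_near. Qed.

Lemma diff_grad (R : realType) n (f : 'cV[R]_n -> R) u d :
  differentiable f u -> 'd f u d = dot (grad f u) d.
Proof.
move=> df; have dE : d = \sum_j d j 0 *: delta_mx j 0.
  rewrite [LHS]matrix_sum_delta; apply: eq_bigr => j _.
  by rewrite big_ord_recl big_ord0 addr0.
rewrite {1}dE linear_sum dotE; apply: eq_bigr => j _.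
by rewrite linearZ /= mxE deriveE// mulrC.
Qed.

End right_derivative.

(** * The link optimization problem *)

Section hits.
Local Open Scope classical_set_scope.
Variables (R : realType) (n : nat) (obl proh fac : {set 'I_n * 'I_n}) (xi : R).
Hypothesis xi_gt0 : 0 < xi.

(** The constraints of [feasible] on the matrix alone: they are checked for
    $A + tH$ before its eigenvector is produced. *)
Definition admissible (A : 'M[R]_n) : Prop :=
  [/\ forall i j, (i, j) \in obl -> A i j = 1,
      forall i j, (i, j) \in proh -> A i j = 0
    & forall i j, (i, j) \in fac -> 0 <= A i j <= 1].

Lemma hits_mx_sym (A : 'M[R]_n) : (hits_mx xi A)^T = hits_mx xi A.
Proof.
by rewrite /hits_mx linearD linearZ /= !trmx_mul !trmxK.
Qed.

Lemma hits_mx_gt0 (A : 'M[R]_n) :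
  (forall i j, 0 <= A i j) -> forall i j, 0 < hits_mx xi A i j.
Proof.
move=> A0 i j; rewrite !mxE big_ord_recl big_ord0 !mxE addr0 mulr1 mulr1.
by rewrite ltr_wpDl// sumr_ge0// => k _; rewrite mxE mulr_ge0.
Qed.

Hypothesis part : link_partition obl proh fac.

Lemma admissible_ge0 A : admissible A -> forall i j, 0 <= A i j.
Proof.
move=> [Ao Ap Af] i j; have [_ _ _ /setP/(_ (i, j))] := part.
rewrite !inE => /orP[/orP[/Ao->|/Ap->]|/Af/andP[]] //.
Qed.

(** The term of [wvec] along $u^T$ is killed because the left kernel of the
    Drazin inverse contains $u^T$ ([drazin_coker]). *)
Lemma wvecE f (A : 'M[R]_n) (u : 'cV[R]_n) rho :
  hits_mx xi A *m u = rho *: u ->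
  (wvec xi f A u rho)^T = - ((grad f u)^T *m drazin (hits_mx xi A - rho%:M)).
Proof.
move=> Au; rewrite trmxK mulmxDl mulNmx -scalemxAl drazin_coker ?scaler0 ?addr0//.
  by rewrite linearB /= hits_mx_sym tr_scalar_mx.
by rewrite mulmxBl mul_scalar_mx Au subrr.
Qed.

Lemma hits_mx_deriv (A H : 'M[R]_n) :
  t^-1 *: (hits_mx xi (A + t *: H) - hits_mx xi A) @[t --> 0^'+] -->
    A^T *m H + H^T *m A.
Proof.
have lim : A^T *m H + H^T *m A + t *: (H^T *m H) @[t --> 0^'+] -->
    A^T *m H + H^T *m A + (0 : R) *: (H^T *m H).
  apply: cvgD; first exact: cvg_cst.
  apply: cvgZ; last exact: cvg_cst.
  exact: cvg_at_right_filter cvg_id.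
rewrite scale0r addr0 in lim; apply: cvg_trans lim; apply: near_eq_cvg; near=> t.
rewrite /hits_mx opprD addrACA subrr addr0.
have -> : (A + t *: H)^T = A^T + t *: H^T.
  by apply/matrixP => i j; rewrite !mxE.
have -> : (A^T + t *: H^T) *m (A + t *: H) - A^T *m A =
    t *: (A^T *m H + H^T *m A + t *: (H^T *m H)).
  rewrite mulmxDl !mulmxDr -!scalemxAl -!scalemxAr.
  by rewrite [LHS]addrC -[X in _ + X]addrA addKr !scalerDr !addrA.
by rewrite scalerA mulVf// scale1r.
Unshelve. all: by end_near. Qed.

(** The eigenpairs of the matrices built from $A + tH$ form, with $A + tH$, a
    curve of feasible points converging to the maximizer, so the right derivative
    of the objective along it, which is the left-hand side, is nonpositive. *)
Lemma first_order_condition f A u rho H :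
  differentiable f u -> local_maximizer obl proh fac xi f A u rho ->
  (\forall t \near 0^'+, admissible (A + t *: H)) ->
  dot (wvec xi f A u rho) ((A^T *m H + H^T *m A) *m u) <= 0.
Proof.
move=> df [[Au u1 u0 admA] fmax] admH.
have A0 := admissible_ge0 admA.
have {}u1 := (norm2_1P u).1 u1.
have n_gt0 : (0 < n)%N.
  rewrite lt0n; apply/eqP => n0; have := u1; rewrite dotE big1.
    by move/eqP; rewrite eq_sym oner_eq0.
  by move=> j _; have := ltn_ord j; rewrite [X in (_ < X)%N]n0.
have perron t : exists p : 'cV[R]_n * R, admissible (A + t *: H) ->
    [/\ hits_mx xi (A + t *: H) *m p.1 = p.2 *: p.1, dot p.1 p.1 = 1
      & forall j, 0 <= p.1 j 0].
  have [adm|//] := pselect (admissible (A + t *: H)); last by exists (u, rho).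
  have M0 i j : 0 <= hits_mx xi (A + t *: H) i j.
    by rewrite ltW// hits_mx_gt0//; exact: admissible_ge0.
  by have [v [r vr]] := nonneg_eigenvector (hits_mx_sym _) M0 n_gt0; exists (v, r).
have [p pP] := choice perron.
pose v t := (p t).1; pose r t := (p t).2.
have v_eigen : \forall t \near 0^'+, [/\ hits_mx xi (A + t *: H) *m v t = r t *: v t,
    dot (v t) (v t) = 1 & forall j, 0 <= v t j 0].
  by apply: filterS admH => t /pP.
pose M t := hits_mx xi (A + t *: H).
have M_deriv := @hits_mx_deriv A H.
have Msym := hits_mx_sym A; have Mgt0 := hits_mx_gt0 A0.
have v_cvg : v t @[t --> 0^'+] --> u.
  exact: (@eigenvector_cvg _ _ _ _ _ Msym Mgt0 Au u1 u0 M _ v r M_deriv v_eigen).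
have r_cvg : r t @[t --> 0^'+] --> rho.
  exact: (@eigenvalue_cvg _ _ _ _ _ Msym Mgt0 Au u1 u0 M _ v r M_deriv v_eigen).
have v_deriv := (@eigenvector_deriv _ _ _ _ _ Msym Mgt0 Au u1 u0 M _ v r M_deriv v_eigen).
have := right_deriv_comp df v_cvg v_deriv.
rewrite diff_grad//.
have -> : dot (grad f u) (- (drazin (hits_mx xi A - rho%:M) *m
    ((A^T *m H + H^T *m A) *m u))) =
    dot (wvec xi f A u rho) ((A^T *m H + H^T *m A) *m u).
  by rewrite /dot wvecE// mulmxN mulNmx -!mulmxA.
move=> f_deriv; apply: (cvgr_to_le f_deriv).
have A_cvg : A + t *: H @[t --> 0^'+] --> A.
  have lim : A + t *: H @[t --> 0^'+] --> A + (0 : R) *: H.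
    apply: cvgD; first exact: cvg_cst.
    by apply: cvgZ; [exact: cvg_at_right_filter cvg_id|exact: cvg_cst].
  by rewrite scale0r addr0 in lim.
have curve_cvg : (A + t *: H, v t, r t) @[t --> 0^'+] --> (A, u, rho).
  exact: cvg_pair (cvg_pair A_cvg v_cvg) r_cvg.
have f_le := curve_cvg _ fmax.
near=> t.
have [Mv v1 v0] : [/\ hits_mx xi (A + t *: H) *m v t = r t *: v t,
  dot (v t) (v t) = 1 & forall j, 0 <= v t j 0] by near: t.
rewrite pmulr_rle0 ?invr_gt0// subr_le0.
have feas : feasible obl proh fac xi (A + t *: H) (v t) (r t).
  by split=> //; [exact/norm2_1P|near: t].
by move: feas; near: t.
Unshelve. all: by end_near. Qed.

(** In the direction $s E_{ij}$ the derivative is $s$ times the $(i,j)$ entry of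
    $(Aw) u^T + (Au) w^T$. *)
Lemma dot_direction (A : 'M[R]_n) (u w : 'cV[R]_n) s i j :
  dot w ((A^T *m (s *: delta_mx i j) + (s *: delta_mx i j)^T *m A) *m u) =
  s * ((A *m w) i 0 * u j 0 + (A *m u) i 0 * w j 0).
Proof.
have E x y : dot x (delta_mx i j *m y) = x i 0 * y j 0.
  rewrite dotE (bigD1 i)//= big1 => [|k ki]; rewrite mxE (bigD1 j)//= mxE.
    rewrite !eqxx mul1r big1 ?addr0// => l lj.
    by rewrite mxE (negbTE lj) andbF mul0r.
  rewrite (negbTE ki) mul0r add0r big1 ?mulr0// => l lj.
  by rewrite mxE (negbTE lj) andbF mul0r.
rewrite mulmxDl dotDr -!mulmxA !dot_mulmx !trmxK -!dot_mulmx.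
rewrite -!scalemxAl dotZr dotZl E [dot _ (A *m u)]dotC E.
by rewrite mulrDr.
Qed.

Lemma admissible_direction (A : 'M[R]_n) (s : R) i j :
  admissible A -> (i, j) \in fac ->
  (\forall t \near 0^'+, 0 <= A i j + t * s <= 1) ->
  \forall t \near 0^'+, admissible (A + t *: (s *: delta_mx i j)).
Proof.
move=> [Ao Ap Af] ijf; have [_ of_ pf _] := part.
have entry t k l : (A + t *: (s *: delta_mx i j)) k l =
    if (k, l) == (i, j) then A i j + t * s else A k l.
  rewrite !mxE xpair_eqE; case: (eqVneq k i) (eqVneq l j) => [->|_] [->|_] /=;
  by rewrite ?mulr1 ?mulr0 ?addr0.
apply: filterS => t A01; split=> k l kl; rewrite entry; case: eqP => [klE|_]; auto.
- by have := disjointFr of_ kl; rewrite klE ijf.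
- by have := disjointFr pf kl; rewrite klE ijf.
Qed.

(** Otherwise the link could be moved in the direction $+E_{ij}$ or $-E_{ij}$,
    against [first_order_condition]. *)
Lemma facultative_weight f A u rho i j (w := wvec xi f A u rho) :
  differentiable f u -> local_maximizer obl proh fac xi f A u rho ->
  (i, j) \in fac ->
  let D := (A *m w) i 0 * u j 0 + (A *m u) i 0 * w j 0 in
  (0 < D -> A i j = 1) /\ (D < 0 -> A i j = 0).
Proof.
move=> df Amax ijf D.
have [[_ _ _ admA] _] := Amax.
have [A0 A1] : 0 <= A i j /\ A i j <= 1.
  by have [_ _ /(_ i j ijf)/andP] := admA.
have dir s : (\forall t \near 0^'+, 0 <= A i j + t * s <= 1) -> s * D <= 0.
  move=> /(admissible_direction admA ijf) adm.
  by have := first_order_condition df Amax adm; rewrite dot_direction.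
split=> [D0|D0]; apply/eqP; apply: contraT => Aij.
- have Alt1 : A i j < 1 by rewrite lt_neqAle Aij.
  have : 1 * D <= 0.
    apply: dir; near=> t; rewrite mulr1 addr_ge0//= -lerBrDl.
    by near: t; apply: nbhs_right_le; rewrite subr_gt0.
  by rewrite mul1r leNgt D0.
- have Agt0 : 0 < A i j by rewrite lt_neqAle eq_sym Aij.
  have : -1 * D <= 0.
    apply: dir; near=> t; rewrite mulrN1 subr_ge0 lerBlDr ler_wpDr// andbT.
    by near: t; apply: nbhs_right_le.
  by rewrite mulN1r oppr_le0 leNgt D0.
Unshelve. all: by end_near. Qed.

End hits.

Unset Implicit Arguments.

Theorem proposition9 (R : realType) (n : nat)
  (obl proh fac : {set 'I_n * 'I_n}) (xi : R) (f : 'cV[R]_n -> R)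
  (A : 'M[R]_n) (u : 'cV[R]_n) (rho : R)
  (Hpart : link_partition obl proh fac)
  (Hxi : 0 < xi)
  (Hf : continuously_differentiable f)
  (Hmax : local_maximizer obl proh fac xi f A u rho) :
  let w := wvec xi f A u rho in
  let b := threshold A u w in
  (forall i : 'I_n, controlled fac i -> has_outlink A i ->
     forall j : 'I_n, (i, j) \in fac ->
       (b i < w j 0 / u j 0 -> A i j = 1) /\
       (w j 0 / u j 0 < b i -> A i j = 0)) /\
  (forall i k : 'I_n,
     controlled fac i -> has_outlink A i ->
     controlled fac k -> has_outlink A k ->
     b i <> b k ->
     fac_outlinks fac i = fac_outlinks fac k ->
     activated_outlinks fac A i \subset activated_outlinks fac A k \/
     activated_outlinks fac A k \subset activated_outlinks fac A i).
Proof.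
move=> w b.
have [df _] := Hf.
have [[Au u1 u_ge0 admA] _] := Hmax.
have A_ge0 := admissible_ge0 Hpart admA.
have u_neq0 : u <> 0.
  move=> u0; have /norm2_1P := u1.
  by rewrite u0 dot0r => /eqP; rewrite eq_sym oner_eq0.
have u_gt0 := eigenvector_gt0 (hits_mx_gt0 Hxi A_ge0) Au u_ge0 u_neq0.
have Au_gt0 i : has_outlink A i -> 0 < (A *m u) i 0.
  move=> [j Aij]; rewrite mxE (bigD1 j)//= ltr_wpDr ?mulr_gt0//.
  by rewrite sumr_ge0// => k _; rewrite mulr_ge0.
have weights i j : has_outlink A i -> (i, j) \in fac ->
    (b i < w j 0 / u j 0 -> A i j = 1) /\ (w j 0 / u j 0 < b i -> A i j = 0).
  move=> iout ijf.
  have [up down] := facultative_weight Hxi Hpart (df u) Hmax ijf.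
  (* The comparison with the threshold is multiplied by $(Au)_i u_j > 0$. *)
  rewrite /b /threshold; split.
    rewrite ltr_pdivrMr ?Au_gt0// mulrAC ltr_pdivlMr// => h; apply: up.
    by move: h; lra.
  rewrite ltr_pdivlMr ?Au_gt0// mulrAC ltr_pdivrMr// => h; apply: down.
  by move: h; lra.
split=> [i _ iout j|i k _ iout _ kout bik facE]; first exact: weights.
have nested i1 k1 : has_outlink A i1 -> has_outlink A k1 ->
    fac_outlinks fac i1 = fac_outlinks fac k1 -> b i1 < b k1 ->
    activated_outlinks fac A k1 \subset activated_outlinks fac A i1.
  move=> i1out k1out /setP E b_lt.
  apply/fintype.subsetP => j; rewrite !inE => /andP[kj Akj].
  have ij : (i1, j) \in fac by have := E j; rewrite !inE kj.
  have [_ down] := weights _ _ k1out kj; have [up _] := weights _ _ i1out ij.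
  rewrite ij /= up ?ltr01// (lt_le_trans b_lt)// leNgt; apply/negP => /down Akj0.
  by rewrite Akj0 ltxx in Akj.
have /orP[/nested|/nested] : (b i < b k) || (b k < b i) by rewrite -neq_lt; apply/eqP.
  by right; auto.
by left; auto.
Qed.
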